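(* Let $\mathcal{H}=L^2([0,1])$, let $\{\varepsilon_k\}_{k\in\mathbb{Z}}$ be i.i.d. random functions in $\mathcal{H}$, let $\delta\in\mathcal{H}^+$, and let $\beta$ be a bounded non-negative kernel operator on $\mathcal{H}$, $\beta(x)(t)=\int\beta(t,s)x(s)\,ds$. Let $\alpha>0$ be such that $E\{K(\varepsilon_1^2)\}^\alpha<1$, where $K(\varepsilon_1^2)=\big(\int\int\beta^2(t,s)\varepsilon_1^4(s)\,ds\,dt\big)^{1/2}$, and let $\{(y_k,\sigma_k^2)\}$ be the unique strictly stationary solution in $\mathcal{H}$ of $y_k=\varepsilon_k\sigma_k$, $\sigma_k^2=\delta+\beta(y_{k-1}^2)$, $k\in\mathbb{Z}$. Then $$E\{\|\sigma_0^2\|_{\mathcal{H}}\}^\alpha<\infty.$$ If moreover $E\{\|\sigma_0\|_{\mathcal{H}}\}^\alpha<\infty$ and $E\{\|\varepsilon_0\|_\infty\}^\alpha<\infty$, then $$E\{\|y_0\|_{\mathcal{H}}\}^\alpha<\infty.$$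
   Context: All integrals are over $[0,1]$. $\mathcal{H}=L^2([0,1])$ has norm $\|x\|_{\mathcal{H}}=(\int x^2(s)ds)^{1/2}$; $\mathcal{H}^+$ is the set of non-negative functions in $\mathcal{H}$; $\|x\|_\infty$ is the (essential) supremum of $|x|$ on $[0,1]$. Products, squares and square roots of functions are pointwise. A non-negative operator is one mapping $\mathcal{H}^+$ into $\mathcal{H}^+$; the same symbol $\beta$ denotes the kernel and the operator. A solution in $\mathcal{H}$ is a process $\{(y_k,\sigma_k^2)\}_{k\in\mathbb{Z}}$ such that $\sigma_k^2$ is a random element of $\mathcal{H}^+$, $\sigma_k\ge 0$ is its pointwise square root, $y_k=\varepsilon_k\sigma_k$, and $\sigma_k^2(t)=\delta(t)+\int\beta(t,s)y_{k-1}^2(s)\,ds$ for a.e. $t$, almost surely. Under the stated condition $E\{K(\varepsilon_1^2)\}^\alpha<1$ there is a unique strictly stationary solution, and it satisfies $\sigma_k^2=g(\varepsilon_{k-1},\varepsilon_{k-2},\ldots)$ for a measurable functional $g:\mathcal{H}^{\mathbb{N}}\to\mathcal{H}$. *)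

(* Defs.v *)
From HB Require Import structures.
From mathcomp Require Import all_boot all_order all_algebra.
From mathcomp Require Import all_classical all_reals all_analysis.
From mathcomp Require Import measurable_realfun.

Set Implicit Arguments.
Unset Strict Implicit.
Unset Printing Implicit Defensive.
Import Order.TTheory GRing.Theory Num.Theory.
Import numFieldNormedType.Exports.

Local Open Scope classical_set_scope.
Local Open Scope ring_scope.
Local Open Scope ereal_scope.

(* Open sets of T for a distance with values in [0, +oo]. *)
Definition dist_open (R : realType) (T : Type) (dist : T -> T -> \bar R) :
    set (set T) :=
  [set U | forall x, U x ->
    exists2 r : R, (0 < r)%R & forall z, dist x z < r%:E -> U z].

Section function_spaces.
Variable R : realType.

Lemma measurable_itv01 :
  measurable ([set` `[0%R, 1%R]] : set (measurableTypeR R)).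
Proof. exact: measurable_itv. Qed.

Lemma lebesgue_itv01_lty : (@lebesgue_measure R) [set` `[0%R, 1%R]] < +oo.
Proof. by rewrite lebesgue_measure_itv /= lte_fin ltr01 -EFinB ltry. Qed.

(* Lebesgue measure of [0, 1] as a measure on the line: a function on [0, 1] is
   represented by a function on R, whose values off [0, 1] are irrelevant. *)
Definition leb01 : {finite_measure set (measurableTypeR R) -> \bar R} :=
  mfrestr measurable_itv01 lebesgue_itv01_lty.

(* Measurable functions modulo equality a.e. on [0, 1]. *)
Definition L0 := {mfun_ leb01, measurableTypeR R >-> measurableTypeR R}.
HB.instance Definition _ := Choice.on L0.

Definition H := LspaceType2 leb01.
HB.instance Definition _ := gen_eqMixin H.
HB.instance Definition _ := gen_choiceMixin H.

Definition L0_fun : L0 -> R -> R := @aqEqMfun_to_fun _ _ _ _ _ leb01.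
Definition H_fun (x : H) : R -> R := L0_fun (LebesgueSpace.sort x).

Definition L0_zero : {mfun_ leb01, measurableTypeR R >-> measurableTypeR R} :=
  (\pi_({mfun_ leb01, measurableTypeR R >-> measurableTypeR R})
     (cst (0%R : measurableTypeR R)))%qT.
HB.instance Definition _ := isPointed.Build L0 L0_zero.

Lemma L0_zero_finite : finite_norm leb01 2 (L0_fun L0_zero).
Proof.
have h : L0_fun L0_zero = cst 0%R %[ae leb01].
  have := @reprK _ _ L0_zero.
  by rewrite [in RHS]/L0_zero => /eqmodP /asboolP.
rewrite /finite_norm unlock poweR_lty//.
rewrite (_ : \int[_]_x _ = \int[leb01]_x 0); first by rewrite integral0 ltry.
apply: ge0_ae_eq_integral => //=.
- apply/measurable_EFinP/(measurableT_comp (measurable_powR _)).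
  apply: (measurableT_comp (@normr_measurable _ _)).
  exact: (measurable_funPT (repr L0_zero)).
- apply: (@filterS _ _ (ae_filter_ringOfSetsType leb01) _ _ _ h) => x /= -> // _.
  by rewrite normr0 powR0.
Qed.

HB.instance Definition _ :=
  isFinLebesgue.Build _ _ R leb01 2 (lee1n 2) L0_zero L0_zero_finite.
HB.instance Definition _ := isPointed.Build H (L0_zero : LspaceType leb01 (lee1n 2)).

Definition normH (x : R -> R) : \bar R := 'N[leb01]_2[EFin \o x].

Definition norm_sup (x : R -> R) : \bar R := 'N[leb01]_+oo[EFin \o x].

Definition distH (x z : H) : \bar R :=
  normH (fun t => H_fun x t - H_fun z t)%R.

(* This distance metrizes convergence in measure. *)
Definition distL0 (x z : L0) : \bar R :=
  \int[leb01]_t (Num.min `|L0_fun x t - L0_fun z t| 1)%:E.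

Definition borelH := g_sigma_algebraType (dist_open distH).
Definition borelL0 := g_sigma_algebraType (dist_open distL0).

Definition nonneg_fun (x : R -> R) : Prop := \forall t \ae leb01, (0 <= x t)%R.

Definition kernel_op (beta : R -> R -> R) (x : R -> R) (t : R) : \bar R :=
  \int[leb01]_s (beta t s * x s)%:E.

Definition bounded_kernel_operator (beta : R -> R -> R) : Prop :=
  [/\ measurable_fun [set: measurableTypeR R * measurableTypeR R]
        (fun p => beta p.1 p.2),
      forall x : H, \forall t \ae leb01,
        leb01.-integrable setT (fun s => (beta t s * H_fun x s)%:E) &
      exists C : R, forall x : H,
        'N[leb01]_2[kernel_op beta (H_fun x)] <= C%:E * normH (H_fun x)].

Definition nonneg_operator (beta : R -> R -> R) : Prop :=
  forall x : H, nonneg_fun (H_fun x) ->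
    \forall t \ae leb01, 0 <= kernel_op beta (H_fun x) t.

Definition K (beta : R -> R -> R) (x : R -> R) : \bar R :=
  (\int[leb01]_t \int[leb01]_s (beta t s ^+ 2 * x s ^+ 2)%:E) `^ 2^-1.

End function_spaces.

Section processes.
Context (R : realType) (d d' : measure_display).
Context (Omega : measurableType d) (S : measurableType d').
Variable P : probability Omega R.

Definition identically_distributed (X : int -> {RV P >-> S}) : Prop :=
  forall (j k : int) (B : set S), measurable B ->
    P (X j @^-1` B) = P (X k @^-1` B).

Definition independent (X : int -> {RV P >-> S}) : Prop :=
  forall (s : seq int) (B : int -> set S), uniq s ->
    (forall k, measurable (B k)) ->
    P (\bigcap_(k in [set` s]) (X k @^-1` B k)) =
    \prod_(k <- s) P (X k @^-1` B k).

Definition iid (X : int -> {RV P >-> S}) : Prop :=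
  independent X /\ identically_distributed X.

Definition cylinders : set (set (int -> S)) :=
  [set C | exists k (B : set S), measurable B /\ C = [set f | B (f k)]].

(* The law on path space, with the product sigma-algebra, is shift invariant. *)
Definition strictly_stationary (X : int -> Omega -> S) : Prop :=
  forall (h : int) (A : set (int -> S)), <<s cylinders>> A ->
    P [set w | A (fun k => X (k + h)%R w)] = P [set w | A (fun k => X k w)].

End processes.

Section garch.
Context (R : realType) (d : measure_display) (Omega : measurableType d).
Variable P : probability Omega R.

(* The second equation holds in \bar R, so it includes the finiteness of the
   integral. The functions y_k are not assumed to lie in H. *)
Definition garch_solution (eps : int -> {RV P >-> borelH R})
    (delta : H R) (beta : R -> R -> R)
    (y : int -> {RV P >-> borelL0 R}) (sigma2 : int -> {RV P >-> borelH R}) :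
    Prop :=
  [/\ forall k w, nonneg_fun (H_fun (sigma2 k w)),
      forall k, \forall w \ae P, \forall t \ae leb01 R,
        L0_fun (y k w) t =
        (H_fun (eps k w) t * Num.sqrt (H_fun (sigma2 k w) t))%R &
      forall k, \forall w \ae P, \forall t \ae leb01 R,
        (H_fun (sigma2 k w) t)%:E =
        (H_fun delta t)%:E +
        kernel_op beta (fun s => L0_fun (y (k - 1)%R w) s ^+ 2)%R t].

End garch.

(* Main.v *)
Require Import Defs.
From HB Require Import structures.
From mathcomp Require Import all_boot all_order all_algebra.
From mathcomp Require Import all_classical all_reals all_analysis.
From mathcomp Require Import measurable_realfun ess_sup_inf ring lra.

(* Write Q_k for the square of the norm of sigma_k^2. The Cauchy-Schwarz
   inequality, applied to the kernel for each t, gives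
   |sigma_k^2(t)| <= delta(t) + (int beta(t,s)^2 eps_{k-1}(s)^4 ds)^(1/2) Q_{k-1}^(1/2).
   Since (a + b)^p <= C a^p + lambda b^p for any lambda > 1, the variables
   M_k = Q_k^(alpha/2) satisfy M_k <= C + A_{k-1} M_{k-1}, where
   A_k = kappa^2 K(eps_k^2)^alpha still has mean r < 1 if kappa > 1 is close to 1.
   Unfolding n times, M_0 is at most C sum_{j<n} A_{-1}...A_{-j} plus the
   remainder A_{-1}...A_{-n} M_{-n}. A stationary solution is not assumed to be
   causal, so M_{-n} need not be independent of the product; but the product has
   mean r^n and M_{-n} is distributed as M_0, so the remainder tends to 0 in
   probability, and truncating at a level L before integrating removes it.
   The bound on M_0 only involves the past of eps, hence it can be multiplied by a
   function u of the independent eps_0: E (u(eps_0) M_0) is finite as soon as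
   E u(eps_0) is. Taking u = 1 gives the first claim, and u the power alpha of the
   supremum norm gives the second one, because
   |y_0|^2 <= |eps_0|_infty^2 int sigma_0^2 and sigma_0^2 <= 1 + sigma_0^4. *)

Set Implicit Arguments.
Unset Strict Implicit.
Unset Printing Implicit Defensive.
Import Order.TTheory GRing.Theory Num.Theory.
Import numFieldNormedType.Exports.

Local Open Scope classical_set_scope.
Local Open Scope ring_scope.
Local Open Scope ereal_scope.

(** * Independence: expectations of products over distinct times *)

Section independence.
Import HBNNSimple.
Context (R : realType) (d d' : measure_display).
Context (Omega : measurableType d) (S : measurableType d').
Variable P : probability Omega R.
Implicit Types (X : {mfun Omega >-> S}) (Z : Omega -> \bar R).

(** A simple function is the finite sum over its range of values times indicators, and a finite sum
    commutes with the integral. *)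
Lemma integral_nnsfun_comp_mul X Z (h : {nnsfun S >-> R}) :
  measurable_fun setT Z -> (forall w, 0 <= Z w) ->
  \int[P]_w ((h (X w))%:E * Z w) =
  \sum_(r \in range h)
    r%:E * \int[P]_w ((\1_(X @^-1` (h @^-1` [set r])) w)%:E * Z w).
Proof.
move=> mZ Z0.
have mpre r : measurable (X @^-1` (h @^-1` [set r])).
  by rewrite -(setTI (X @^-1` _)); exact: measurable_funPT.
have mI r : measurable_fun setT
    (fun w => (\1_(X @^-1` (h @^-1` [set r])) w)%:E * Z w).
  by apply: emeasurable_funM => //; apply/measurable_EFinP/measurable_indic.
have rI0 r w : 0 <= r%:E * (\1_(X @^-1` (h @^-1` [set r])) w)%:E.
  exact: (nnfun_muleindic_ge0 h r (X w)).
transitivity (\int[P]_w \sum_(r \in range h)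
    (r%:E * ((\1_(X @^-1` (h @^-1` [set r])) w)%:E * Z w))).
  apply: eq_integral => w _; rewrite (fimfunE h (X w)) -fsumEFin//.
  rewrite ge0_mule_fsuml; last by move=> r; exact: rI0.
  by apply: eq_fsbigr => r _; rewrite EFinM muleA.
rewrite ge0_integral_fsum//.
- apply: eq_fsbigr => r; rewrite inE => -[s _ <-].
  by rewrite ge0_integralZl_EFin// => w _; apply: mule_ge0; rewrite // lee_fin.
- by move=> r; apply: emeasurable_funM.
- by move=> r w _; rewrite muleA mule_ge0.
Qed.

(** Standard extension: agreement on indicators passes to simple functions by linearity and to
    non-negative measurable [f] by monotone convergence. With [Z'] constant this turns independence
    of events into a factorization of integrals. *)
Lemma eq_integral_comp_mul X Z Z' (f : S -> \bar R) :
    measurable_fun setT Z -> (forall w, 0 <= Z w) ->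
    measurable_fun setT Z' -> (forall w, 0 <= Z' w) ->
    measurable_fun setT f -> (forall s, 0 <= f s) ->
    (forall B, measurable B -> \int[P]_w ((\1_(X @^-1` B) w)%:E * Z w) =
                               \int[P]_w ((\1_(X @^-1` B) w)%:E * Z' w)) ->
  \int[P]_w (f (X w) * Z w) = \int[P]_w (f (X w) * Z' w).
Proof.
move=> mZ Z0 mZ' Z'0 mf f0 ZZ'.
pose h := nnsfun_approx measurableT mf.
have approx Y : measurable_fun setT Y -> (forall w, 0 <= Y w) ->
    \int[P]_w (f (X w) * Y w) = limn (fun n => \int[P]_w ((h n (X w))%:E * Y w)).
  move=> mY Y0; rewrite -monotone_convergence//.
  - apply: eq_integral => w _; apply/esym/cvg_lim => //.
    have hf : (h n (X w))%:E @[n --> \oo] --> f (X w).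
      by apply: (@cvg_nnsfun_approx _ _ _ _ measurableT _ mf) => // s _.
    (* Convergence of the products is not automatic at [0 * +oo], so the two ways of having a zero
       factor come first. If [f (X w) = 0], every approximation vanishes there, since they increase
       to [0]. *)
    have [y0|y0] := eqVneq (Y w) 0.
      by under eq_fun do rewrite y0 mule0; rewrite y0 mule0; exact: cvg_cst.
    have [f00|fn0] := eqVneq (f (X w)) 0.
      have h0 n : (h n (X w))%:E = 0.
        apply/eqP; rewrite eq_le; apply/andP; split; last by rewrite lee_fin.
        rewrite -f00 -(cvg_lim _ hf)//; apply: lime_ge.
          by apply/cvg_ex; exists (f (X w)).
        by exists n => // m /= nm; rewrite lee_fin; exact/lefP/nd_nnsfun_approx.
      by under eq_fun do rewrite h0 mul0e; rewrite f00 mul0e; exact: cvg_cst.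
    apply: cvgeM => //; last exact: cvg_cst.
    by rewrite neq0_mule_def// mule_eq0 negb_or fn0.
  - move=> n; apply: emeasurable_funM => //; apply/measurable_EFinP.
    by apply: measurableT_comp => //; exact: measurable_funPT.
  - by move=> n w _; rewrite mule_ge0// lee_fin.
  - move=> w _ m n mn; rewrite lee_wpmul2r// lee_fin.
    exact/lefP/nd_nnsfun_approx.
rewrite !approx//; congr (limn _); apply/funext => n.
rewrite !integral_nnsfun_comp_mul//; apply: eq_fsbigr => r _.
by rewrite ZZ'.
Qed.

Lemma bigcap_preimage_measurable (X : int -> {RV P >-> S}) (B : int -> set S)
    (t : seq int) : (forall k, measurable (B k)) ->
  measurable (\bigcap_(k in [set` t]) (X k @^-1` B k)).
Proof.
move=> mB; apply: fin_bigcap_measurable; first exact: finite_seq.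
by move=> k _; rewrite -(setTI (X k @^-1` _)); exact: measurable_funPT.
Qed.

Lemma emeasurable_prod (I : Type) (s : seq I) (f : I -> Omega -> \bar R) :
  (forall i, measurable_fun setT (f i)) ->
  measurable_fun setT (fun w => \prod_(i <- s) f i w).
Proof.
move=> mf; elim: s => [|i s IH].
  by under eq_fun do rewrite big_nil; exact: measurable_cst.
by under eq_fun do rewrite big_cons; exact: emeasurable_funM.
Qed.

(* The events attached to [t] let the functions be introduced one at a time:
   the law of [X k] under a weight [Z] is determined by the
   integrals of [Z] over the events [X k \in B]. *)
Lemma independent_integral_prod_indic (X : int -> {RV P >-> S})
    (f : int -> S -> \bar R) (B : int -> set S) (s t : seq int) :
    independent X -> uniq (s ++ t) ->
    (forall k, measurable_fun setT (f k)) -> (forall k x, 0 <= f k x) ->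
    (forall k, measurable (B k)) ->
  \int[P]_w (\prod_(k <- s) f k (X k w) *
             (\1_(\bigcap_(k in [set` t]) (X k @^-1` B k)) w)%:E) =
  \prod_(k <- s) \int[P]_w f k (X k w) * \prod_(k <- t) P (X k @^-1` B k).
Proof.
move=> indX + mf f0.
have mfX k : measurable_fun setT (fun w => f k (X k w)).
  by apply: measurableT_comp => //; exact: measurable_funPT.
elim: s t B => [|a s IH] t B /= ust mB.
  under eq_integral do rewrite big_nil mul1e.
  rewrite integral_indic//; last exact: bigcap_preimage_measurable.
  by rewrite setIT big_nil mul1e; exact: indX.
move: ust => /andP[anst ust].
have [ans ant] : a \notin s /\ a \notin t.
  by move: anst; rewrite mem_cat negb_or => /andP.
pose Z (u : seq int) (B : int -> set S) w := \prod_(k <- s) f k (X k w) *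
  (\1_(\bigcap_(k in [set` u]) (X k @^-1` B k)) w)%:E.
have Z0 u B' w : 0 <= Z u B' w.
  by rewrite mule_ge0 ?lee_fin//; apply: prode_ge0.
have mZ u B' : (forall k, measurable (B' k)) -> measurable_fun setT (Z u B').
  move=> mB'; apply: emeasurable_funM; first exact: emeasurable_prod.
  exact/measurable_EFinP/measurable_indic/bigcap_preimage_measurable.
pose c := \prod_(k <- s) \int[P]_w f k (X k w) * \prod_(k <- t) P (X k @^-1` B k).
have c0 : 0 <= c.
  by rewrite mule_ge0// prode_ge0// => k _; apply: integral_ge0.
transitivity (\int[P]_w (f a (X a w) * Z t B w)).
  by apply: eq_integral => w _; rewrite big_cons muleA.
(* The weight [Z t B] may be replaced by its mean [c] once its integral over each event [X a \in C]
   is shown to be the probability of that event times [c]. *)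
rewrite (@eq_integral_comp_mul (X a) _ (cst c))//; last 2 first.
- exact: mZ.
- move=> C mC.
  have mXC : measurable (X a @^-1` C).
    by rewrite -(setTI (X a @^-1` _)); exact: measurable_funPT.
  (* [B'] puts [C] at [a] and agrees with [B] on [t], because [a] is not in [t]. The event at [a]
     thus joins [t], and the induction hypothesis applies to [a :: t]. *)
  pose B' k := if k == a then C else B k.
  have mB' k : measurable (B' k) by rewrite /B'; case: ifP.
  have B'a : B' a = C by rewrite /B' eqxx.
  have B't k : k \in t -> B' k = B k.
    by rewrite /B'; case: eqP => // -> ; rewrite (negbTE ant).
  transitivity (\int[P]_w Z (a :: t) B' w).
    apply: eq_integral => w _; rewrite /Z muleCA; congr (_ * _).
    rewrite -EFinM -[LHS]/(((\1_(X a @^-1` C) \* _)%R w)%:E) -indicI.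
    congr (\1__ _)%:E; apply/seteqP; split=> v.
      move=> [Xv tv] k /=; rewrite inE => /orP[/eqP ->|kt]; first by rewrite B'a.
      by rewrite B't//; exact: tv.
    move=> tv; split; first by rewrite -B'a; apply: tv; rewrite /= inE eqxx.
    by move=> k /= kt; rewrite -B't//; apply: tv; rewrite /= inE kt orbT.
  rewrite IH//; last first.
    by rewrite -cat1s uniq_catCA cat1s /= anst.
  rewrite big_cons B'a muleCA.
  rewrite ge0_integralZr//; last first.
    by apply/measurable_EFinP/measurable_indic.
  rewrite integral_indic// setIT; congr (_ * _); congr (_ * _).
  by rewrite big_seq [RHS]big_seq; apply: eq_bigr => k kt; rewrite B't.
by rewrite /= ge0_integralZr// big_cons muleA.
Qed.

Lemma independent_integral_prod (X : int -> {RV P >-> S})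
    (f : int -> S -> \bar R) (s : seq int) :
    independent X -> uniq s ->
    (forall k, measurable_fun setT (f k)) -> (forall k x, 0 <= f k x) ->
  \int[P]_w \prod_(k <- s) f k (X k w) = \prod_(k <- s) \int[P]_w f k (X k w).
Proof.
move=> indX us mf f0.
have := @independent_integral_prod_indic X f (fun=> setT) s [::] indX.
rewrite cats0 big_nil mule1 => <- //; apply: eq_integral => w _.
by rewrite indicE mem_set ?mule1// => k.
Qed.

Lemma identically_distributed_integral (X : int -> {RV P >-> S})
    (f : S -> \bar R) (j k : int) :
    identically_distributed X -> measurable_fun setT f -> (forall x, 0 <= f x) ->
  \int[P]_w f (X j w) = \int[P]_w f (X k w).
Proof.
move=> idX mf f0.
have mX i : measurable_fun setT (X i) by exact: measurable_funPT.
rewrite -[LHS](@ge0_integral_pushforward _ _ _ _ _ _ (mX j) P setT)//.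
rewrite -[RHS](@ge0_integral_pushforward _ _ _ _ _ _ (mX k) P setT)//.
by apply: eq_measure_integral => A mA _; exact: idX.
Qed.

End independence.

(** * Moments from a stochastic recursion with contracting mean *)

Section recursion.
Context (R : realType) (d d' : measure_display).
Context (Omega : measurableType d) (S : measurableType d').
Variable P : probability Omega R.

Lemma lim_mine_nat (x : \bar R) : 0 <= x -> limn (fun n => mine x n%:R%:E) = x.
Proof.
case: x => [r r0|_|//].
  apply/cvg_lim => //; apply: cvg_near_cst.
  exists (Num.truncn r).+1 => // n /= rn.
  rewrite min_l// lee_fin; apply/ltW/(lt_le_trans (truncnS_gt r)).
  by rewrite ler_nat.
apply/cvg_lim => //; rewrite [X in X @ _ --> _](_ : _ = (fun n => n%:R%:E)).
  exact/cvgeryP/cvgr_idn.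
by apply/funext => n; rewrite min_r ?leey.
Qed.

(** Monotone convergence in the truncation level. A bound uniform in [L] survives the limit, while
    each truncated integrand is bounded and so tolerates an exceptional event of small
    probability. *)
Lemma integral_lty_mine (f : Omega -> \bar R) (c : R) :
  measurable_fun setT f -> (forall w, 0 <= f w) ->
  (forall L : nat, \int[P]_w mine (f w) L%:R%:E <= c%:E) ->
  \int[P]_w f w < +oo.
Proof.
move=> mf f0 fc; apply: (@le_lt_trans _ _ c%:E); last exact: ltry.
rewrite (eq_integral (fun w => limn (fun n => mine (f w) n%:R%:E))); last first.
  by move=> w _; rewrite lim_mine_nat.
rewrite monotone_convergence//.
- apply: lime_le; last exact: nearW.
  apply: ereal_nondecreasing_is_cvgn => m n mn; apply: ge0_le_integral => //.
  + by move=> w _; rewrite le_min f0 lee_fin /=.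
  + exact: measurable_mine.
  + exact: measurable_mine.
  + by move=> w _; rewrite le_min2// lee_fin ler_nat.
- by move=> n; exact: measurable_mine.
- by move=> n w _; rewrite le_min f0 lee_fin /=.
- by move=> w _ m n mn; rewrite le_min2// lee_fin ler_nat.
Qed.

(** The tail events decrease to the empty set because [M] is finite everywhere, and [P] is
    continuous from above. *)
Lemma tail_probability_le (M : Omega -> \bar R) (e : R) : measurable_fun setT M ->
  (forall w, M w < +oo) -> (0 < e)%R ->
  exists n : nat, P [set w | n%:R%:E < M w] <= e%:E.
Proof.
move=> mM Moo e0; pose F (n : nat) := [set w | n%:R%:E < M w].
have mF n : measurable (F n).
  by rewrite -[F n]setTI; exact: emeasurable_fun_o_infty.
have F0 : \bigcap_n F n = set0.
  apply/seteqP; split => // w Fw; have [Fw0 Mw] := (Fw 0%N I, Moo w).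
  have [r Mr] : exists r, M w = r%:E.
    by move: Fw0 Mw; rewrite /F /=; case: (M w) => // r _ _; exists r.
  have /= := Fw (Num.truncn r).+1 I.
  by rewrite /F /= Mr lte_fin ltNge (ltW (truncnS_gt r)).
have Fnd : {homo F : n m / (n <= m)%N >-> (m <= n)%O}.
  move=> m n mn; apply/subsetPset => w; apply: le_lt_trans.
  by rewrite lee_fin ler_nat.
have PF : fine (P (F n)) @[n --> \oo] --> (0 : R)%R.
  apply: fine_cvg; rewrite [X in _ --> X](_ : _ = P (\bigcap_n F n)); last first.
    by rewrite F0 measure0.
  apply: nonincreasing_cvg_mu => //; last by rewrite F0.
  by rewrite -ge0_fin_numE// fin_num_measure.
have [N _ /(_ N (leqnn N))/= PN] := cvgr_lt _ PF _ e0.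
exists N; rewrite -[X in P X]/(F N) -(@fineK _ (P (F N))) ?fin_num_measure//.
by rewrite lee_fin ltW.
Qed.

Lemma geometric_sum_le (c r : R) (n : nat) : (0 <= c)%R -> (0 <= r < 1)%R ->
  (\sum_(0 <= j < n) c * r ^+ j <= c / (1 - r))%R.
Proof.
move=> c0 /andP[r0 r1]; have r1' : (0 < 1 - r)%R by rewrite subr_gt0.
suff -> : (\sum_(0 <= j < n) c * r ^+ j = c / (1 - r) * (1 - r ^+ n))%R.
  rewrite ler_piMr ?divr_ge0 ?(ltW r1')//.
  by rewrite gerBl exprn_ge0.
elim: n => [|n IH]; first by rewrite big_geq// expr0 subrr mulr0.
rewrite big_nat_recr//= IH exprS; have := gt_eqF r1'.
by move/negbT => ?; field.
Qed.

Variable X : int -> {RV P >-> S}.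
Hypothesis iidX : iid X.

Variables (f u : S -> \bar R).
Hypothesis mf : measurable_fun setT f.
Hypothesis f0 : forall x, 0 <= f x.
Hypothesis f_lt1 : \int[P]_w f (X 1%R w) < 1.
Hypothesis mu : measurable_fun setT u.
Hypothesis u0 : forall x, 0 <= u x.
Hypothesis u_lty : \int[P]_w u (X 0%R w) < +oo.

(** The times run from [-1] down to [-n]: time [0], where [u] is evaluated, is left out, so that
    independence separates the two factors. *)
Let past n w := \prod_(0 <= i < n) f (X (- i.+1%:Z)%R w).

Lemma integral_mul_past n : \int[P]_w (u (X 0%R w) * past n w) =
  \int[P]_w u (X 0%R w) * (\int[P]_w f (X 1%R w)) ^+ n.
Proof.
(* A single family indexed by time, equal to [u] at time [0] and to [f] elsewhere, puts the product
   in the form required by independence. *)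
pose g (k : int) := if k == 0%R then u else f.
have g0 k x : 0 <= g k x by rewrite /g; case: ifP.
have mg k : measurable_fun setT (g k) by rewrite /g; case: ifP.
have us : uniq (0%R :: [seq (- i.+1%:Z)%R | i <- iota 0 n]).
  rewrite /= map_inj_uniq ?iota_uniq ?andbT; last by move=> i j /oppr_inj [].
  by apply/mapP => -[i _ /eqP]; rewrite eq_sym oppr_eq0.
have [indX idX] := iidX.
have := independent_integral_prod indX us mg g0.
rewrite big_cons big_map => E.
transitivity (\int[P]_w g 0%R (X 0%R w) * \prod_(i <- iota 0 n)
    \int[P]_w g (- i.+1%:Z)%R (X (- i.+1%:Z)%R w)); last first.
  congr (_ * _); rewrite (eq_bigr (fun=> \int[P]_w f (X 1%R w))).
    by elim: (n) 0%N => [|m IH] k; rewrite ?big_nil// big_cons expeS IH.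
  move=> i _; rewrite /g oppr_eq0 /=.
  exact: (identically_distributed_integral _ _ idX mf f0).
rewrite -E; apply: eq_integral => w _.
by rewrite big_cons big_map /past /index_iota subn0; congr (_ * _).
Qed.

Variables (M : int -> Omega -> \bar R) (C : R).
Hypothesis mM : forall k, measurable_fun setT (M k).
Hypothesis M0 : forall k w, 0 <= M k w.
Hypothesis M_lty : forall w, M 0%R w < +oo.
Hypothesis M_stat : forall k (b : R),
  P [set w | b%:E < M k w] = P [set w | b%:E < M 0%R w].
Hypothesis C0 : (0 <= C)%R.
Hypothesis M_rec : forall k, \forall w \ae P,
  M k w <= C%:E + f (X (k - 1)%R w) * M (k - 1)%R w.

Let past_ge0 n w : 0 <= past n w. Proof. exact: prode_ge0. Qed.

Let measurable_past n : measurable_fun setT (past n).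
Proof.
apply: emeasurable_prod => i.
by apply: measurableT_comp => //; exact: measurable_funPT.
Qed.

Lemma recursion_unfold n : \forall w \ae P,
  M 0%R w <= \sum_(0 <= j < n) C%:E * past j w + past n w * M (- n%:Z)%R w.
Proof.
elim: n => [|n IH].
  by apply: nearW => w; rewrite big_geq// /past big_geq// mul1e add0e oppr0.
have := M_rec (- n%:Z)%R.
move: IH; apply: filterS2 => w IH Mw; apply: (le_trans IH).
rewrite big_nat_recr//= -addeA leeD2l//.
rewrite /past big_nat_recr//= -/(past n w) [past n w * _]muleC.
rewrite -muleA [_ * past n w]muleC.
rewrite [C%:E * _]muleC -ge0_muleDr//; [|by rewrite mule_ge0].
apply: lee_wpmul2l => //; apply: (le_trans Mw).
by rewrite (_ : (- n.+1%:Z) = - n%:Z - 1)%R// intS opprD addrC.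
Qed.

(** For each level [L] the truncated integrand is dominated by [G1 + G2 + G3]: the geometric part of
    the unfolded recursion, the level [L] on the event [F] that [M] at time [-n] exceeds [b], and
    the remainder with [M] replaced by [b]. Their integrals are at most [C * e / (1 - r)], [1] and
    [1], uniformly in [L]. *)
Lemma recursion_integral_lty : \int[P]_w (u (X 0%R w) * M 0%R w) < +oo.
Proof.
have mXu : measurable_fun setT (fun w => u (X 0%R w)).
  by apply: measurableT_comp => //; exact: measurable_funPT.
have [e e0 eE] : exists2 e : R, (0 <= e)%R & \int[P]_w u (X 0%R w) = e%:E.
  exists (fine (\int[P]_w u (X 0%R w))); first exact/fine_ge0/integral_ge0.
  by rewrite fineK// ge0_fin_numE//; exact: integral_ge0.
have [r /andP[r0 r1] rE] : exists2 r : R, (0 <= r < 1)%R &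
    \int[P]_w f (X 1%R w) = r%:E.
  have fE : (fine (\int[P]_w f (X 1%R w)))%:E = \int[P]_w f (X 1%R w).
    rewrite fineK// ge0_fin_numE ?(lt_trans f_lt1) ?ltry//; exact: integral_ge0.
  exists (fine (\int[P]_w f (X 1%R w))) => //.
  by rewrite -lte_fin fE f_lt1 andbT; apply/fine_ge0/integral_ge0.
have upast n : \int[P]_w (u (X 0%R w) * past n w) = (e * r ^+ n)%:E.
  by rewrite integral_mul_past eE rE -EFin_expe EFinM.
have mup n : measurable_fun setT (fun w => u (X 0%R w) * past n w).
  exact: emeasurable_funM.
have up0 n w : 0 <= u (X 0%R w) * past n w by rewrite mule_ge0.
apply: (@integral_lty_mine _ (C * e / (1 - r) + 1 + 1)%R) => [|w|L].
- exact: emeasurable_funM.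
- by rewrite mule_ge0.
(* The order of choices matters: [b] depends on [L] only and makes [L] times the tail probability at
   most [1]; [n] is then taken large for this [b], so that the remainder off [F] has integral at
   most [1]. *)
have [|b Pb] := @tail_probability_le (M 0%R) (L.+1%:R^-1)%R (mM 0%R) M_lty.
  by rewrite invr_gt0.
have [n bn] : exists n, (b%:R * (e * r ^+ n) <= 1)%R.
  have /cvgr_lt : (b%:R * (e * r ^+ n) @[n --> \oo] --> (b%:R * (e * 0))%R)%R.
    by do 2 apply: cvgMr; apply: cvg_expr; rewrite ger0_norm.
  move=> /(_ 1%R); rewrite !mulr0 => /(_ ltr01)[n _ /(_ n (leqnn n))/= bn].
  by exists n; rewrite ltW.
pose F := [set w | b%:R%:E < M (- n%:Z)%R w].
have mF : measurable F by rewrite -[F]setTI; exact: emeasurable_fun_o_infty.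
pose G1 w := \sum_(0 <= j < n) C%:E * (u (X 0%R w) * past j w).
pose G2 w := L%:R%:E * (\1_F w)%:E : \bar R.
pose G3 w := b%:R%:E * (u (X 0%R w) * past n w).
have CU0 j w : 0 <= C%:E * (u (X 0%R w) * past j w) by rewrite mule_ge0.
have mCU j : measurable_fun setT (fun w => C%:E * (u (X 0%R w) * past j w)).
  exact: measurable_funeM.
have G10 w : 0 <= G1 w by apply: sume_ge0.
have G20 w : 0 <= G2 w by rewrite mule_ge0// lee_fin.
have G30 w : 0 <= G3 w by rewrite mule_ge0// lee_fin.
have mG1 : measurable_fun setT G1 by exact: emeasurable_sum.
have mI : measurable_fun setT (fun w => (\1_F w)%:E : \bar R).
  exact/measurable_EFinP/measurable_indic.
have mG2 : measurable_fun setT G2 by exact: measurable_funeM.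
have mG3 : measurable_fun setT G3 by exact: measurable_funeM.
apply: (@le_trans _ _ (\int[P]_w (G1 w + G2 w + G3 w))).
  apply: ae_ge0_le_integral => //.
  - by move=> w _; rewrite le_min mule_ge0// lee_fin /=.
  - by apply: measurable_mine => //; exact: emeasurable_funM.
  - by move=> w _; rewrite !adde_ge0.
  - by do 2 apply: emeasurable_funD => //.
  apply: filterS (recursion_unfold n) => w Mw _.
  (* On [F] the truncation level alone gives the bound [G2]; off [F] the unfolded recursion gives
     [G1 + G3]. *)
  have [Fw|Fw] := ltP b%:R%:E (M (- n%:Z)%R w).
    rewrite ge_min; apply/orP; right.
    apply: (@le_trans _ _ (G2 w)); first by rewrite /G2 indicE mem_set// mule1.
    by rewrite -addeA addeC -addeA leeDl// adde_ge0.
  rewrite ge_min; apply/orP; left.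
  apply: (@le_trans _ _ (G1 w + G3 w)); last by rewrite leeD2r// leeDl.
  apply: (le_trans (lee_wpmul2l (u0 _) Mw)).
  rewrite ge0_muleDr ?sume_ge0//; last 2 first.
  - by move=> j _; rewrite mule_ge0.
  - by rewrite mule_ge0.
  apply: leeD.
    rewrite ge0_sume_distrr; last by move=> j _; rewrite mule_ge0.
    by apply: lee_sum => j _; rewrite muleCA.
  rewrite muleA /G3 muleC; exact: lee_wpmul2r.
rewrite !ge0_integralD//; last 2 first.
- by move=> w _; rewrite adde_ge0.
- exact: emeasurable_funD.
rewrite !EFinD leeD//; last first.
  by rewrite ge0_integralZl// upast -EFinM lee_fin.
rewrite leeD//.
  rewrite ge0_integral_sum//.
  rewrite (eq_bigr (fun j => (C * e * r ^+ j)%:E)); last first.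
    by move=> j _; rewrite ge0_integralZl// upast -EFinM mulrA.
  by rewrite sumEFin lee_fin geometric_sum_le ?mulr_ge0// r0.
rewrite ge0_integralZl//.
rewrite integral_indic// setIT.
(* Stationarity carries the tail from time [-n], where [n] depends on [b], back to time [0], where
   [b] was chosen. *)
rewrite [X in _ * X](_ : _ = P [set w | b%:R%:E < M 0%R w]); last exact: M_stat.
apply: (le_trans (lee_wpmul2l _ Pb)).
  by rewrite lee_fin.
by rewrite -EFinM lee_fin ler_pdivrMr// mul1r ler_nat.
Qed.
End recursion.

(** * Lower limits and measurability of extended real functions *)

Section measurability.
Context (R : realType) (d : measure_display) (T : measurableType d).

Lemma limn_einf_ge0 (v : (\bar R)^nat) : (forall n, 0 <= v n) -> 0 <= limn_einf v.
Proof.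
move=> v0; rewrite limn_einf_lim; apply: lime_ge; first exact: is_cvg_einfs.
by apply: nearW => n; apply: le_ereal_inf_tmp => _ [m _ <-].
Qed.

Lemma limn_einf_le (v : (\bar R)^nat) (a : \bar R) :
  (forall n, v n <= a) -> limn_einf v <= a.
Proof.
move=> va; rewrite limn_einf_lim; apply: lime_le; first exact: is_cvg_einfs.
apply: nearW => n; apply: le_trans (va n).
by apply: ereal_inf_lbound; exists n => /=.
Qed.

Lemma measurable_fun_limn_einf (f : (T -> \bar R)^nat) :
  (forall n, measurable_fun setT (f n)) ->
  measurable_fun setT (fun x => limn_einf (f ^~ x)).
Proof.
move=> mf.
rewrite (_ : (fun _ => _) = (fun x => - limn_esup (fun n => - f n x))).
  by apply: measurableT_comp => //; apply: measurable_fun_limn_esup => n;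
    exact: measurableT_comp.
apply/funext => x; rewrite -limn_einfN; congr limn_einf.
by apply/funext => n; rewrite /= oppeK.
Qed.

Lemma emeasurable_fun_lt (f : T -> \bar R) :
  (forall r : R, measurable [set x | r%:E < f x]) -> measurable_fun setT f.
Proof.
move=> mf; apply: (measurability _ (ErealGenOInfty.measurableE R)) => //.
move=> _ [_ [r ->] <-]; rewrite setTI.
rewrite (_ : _ @^-1` _ = [set x | r%:E < f x])//.
by apply/seteqP; split=> x /=; rewrite in_itv /= andbT.
Qed.
End measurability.

(** * Measurability of norms and kernel functionals of random functions *)

Section functionals.
Variable R : realType.
Local Notation mu := (leb01 R).
Local Notation mR := (measurableTypeR R).
Implicit Types (x z : L0 R) (phi : R -> R) (b : R -> R -> R).

Lemma measurable_L0_fun x : measurable_fun [set: mR] (L0_fun x : mR -> mR).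
Proof. exact: (measurable_funPT (repr x)). Qed.

Lemma measurable_H_fun (x : H R) : measurable_fun [set: mR] (H_fun x : mR -> mR).
Proof. exact: measurable_L0_fun. Qed.

Lemma leb01_setT : mu setT = 1.
Proof.
have -> : mu setT = lebesgue_measure ([set: mR] `&` [set` `[0%R, 1%R]]) by [].
by rewrite setTI lebesgue_measure_itv /= lte_fin ltr01 oppr0 adde0.
Qed.

Lemma measurable_distL0_integrand x z : measurable_fun [set: mR]
  (fun t => (Num.min `|L0_fun x t - L0_fun z t| 1)%:E : \bar R).
Proof.
apply/measurable_EFinP; apply: measurable_minr => //.
apply: measurableT_comp => //; apply: measurable_funB; exact: measurable_L0_fun.
Qed.

(** The radii are summable, so the series of truncated differences has a finite integral; it is
    therefore finite almost everywhere, and its terms tend to [0]. *)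
Lemma distL0_cvg_ae x (z : nat -> L0 R) :
  (forall n, distL0 x (z n) < (2^-1 ^+ n)%R%:E) ->
  \forall t \ae mu, L0_fun (z n) t @[n --> \oo] --> L0_fun x t.
Proof.
move=> xz; pose g n t : \bar R := (Num.min `|L0_fun x t - L0_fun (z n) t| 1)%:E.
have g0 n t : 0 <= g n t by rewrite lee_fin le_min normr_ge0 ler01.
have mg n : measurable_fun [set: mR] (g n) by exact: measurable_distL0_integrand.
have intg : mu.-integrable setT (fun t => \sum_(n <oo) g n t).
  apply/integrableP; split.
    by apply: ge0_emeasurable_sum => // k *; exact: g0.
  rewrite (eq_integral (fun t : mR => \sum_(n <oo) g n t)); last first.
    by move=> t _; rewrite gee0_abs// nneseries_ge0.
  rewrite integral_nneseries//.
  apply: (@le_lt_trans _ _ (\sum_(n <oo) (2^-1 ^+ n)%R%:E)).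
    apply: lee_nneseries => [n _ _|n _]; last exact/ltW/xz.
    by apply: integral_ge0 => t _; exact: g0.
  have h0 : (0 <= (2^-1 : R) < 1)%R by lra.
  apply: (@le_lt_trans _ _ (1 / (1 - 2^-1))%R%:E); last exact: ltry.
  apply: lime_le.
    by apply: is_cvg_nneseries => n _ _; rewrite lee_fin exprn_ge0.
  apply: nearW => n; rewrite sumEFin lee_fin.
  have := @geometric_sum_le R 1 2^-1 n ler01 h0.
  by under eq_bigr do rewrite mul1r.
apply: filterS (integrable_ae measurableT intg) => t /(_ I) gfin.
have gt : \sum_(n <oo) g n t < +oo by rewrite -ge0_fin_numE// nneseries_ge0.
have /= tl := nneseries_tail_cvg gt (fun k _ => g0 k t).
have gcvg : g n t @[n --> \oo] --> 0.
  apply: (@squeeze_cvge _ _ _ _ (cst 0) _ (fun N => \sum_(N <= k <oo) g k t)) => //.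
    apply: nearW => n; rewrite g0 /=.
    rewrite (@nneseries_split _ _ n 1); last by move=> k _.
    by rewrite addn1 big_nat1 leeDl// nneseries_ge0.
  exact: cvg_cst.
apply/cvgrPdist_lt => e e0.
(* Below the threshold [1] the truncation in [distL0] is inactive, so a truncated difference under
   [Num.min e 1] is a true difference under [e]. *)
have e1 : (0 < Num.min e 1)%R by rewrite lt_min e0 ltr01.
have /fine_cvg/cvgr_lt/(_ _ e1) := gcvg.
apply: filterS => n /=; rewrite lt_min => /andP[ge g1].
move: ge; rewrite gt_min => /orP[//|le1].
by move: g1; rewrite gt_min ltxx orbF => /lt_trans; exact.
Qed.

(** Continuity of [phi] makes the left integrand almost everywhere equal to the lower limit of the
    right ones, to which Fatou's lemma applies. *)
Lemma fatou_comp b phi x (z : nat -> L0 R) (t : R) :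
    measurable_fun [set: mR] (b t : mR -> mR) -> (forall s, 0 <= b t s)%R ->
    continuous phi -> (forall r, 0 <= phi r)%R ->
    (\forall s \ae mu, L0_fun (z n) s @[n --> \oo] --> L0_fun x s) ->
  \int[mu]_s (b t s * phi (L0_fun x s))%:E <=
  limn_einf (fun n => \int[mu]_s (b t s * phi (L0_fun (z n) s))%:E).
Proof.
move=> mb b0 cphi phi0 zx.
have mphi y : measurable_fun [set: mR]
    (fun s => (b t s * phi (L0_fun y s))%:E : \bar R).
  apply/measurable_EFinP; apply: measurable_funM => //.
  apply: measurableT_comp; last exact: measurable_L0_fun.
  exact: continuous_measurable_fun.
have bphi0 y s : 0 <= (b t s * phi (L0_fun y s))%:E by rewrite lee_fin mulr_ge0.
apply: le_trans (fatou mu measurableT (fun n => mphi (z n))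
  (fun n s _ => bphi0 (z n) s)).
rewrite le_eqVlt; apply/orP; left; apply/eqP; apply: ge0_ae_eq_integral => //.
- exact: measurable_fun_limn_einf.
- by move=> s _; exact: limn_einf_ge0.
- apply: (@filterS _ _ (ae_filter_ringOfSetsType mu) _ _ _ zx) => s zs _; apply/esym.
  apply: (cvg_limn_einf_sup _).1; apply: cvg_EFin; first exact: nearW.
  by apply: cvgMr; apply: continuous_cvg zs; exact: cphi.
Qed.

(** One shape for three quantities: the square of [K] (squared kernel, fourth power), the squared
    norm of [H] ([b = 1], square), and the mean excess of [|y|] over a level, which detects the
    supremum norm. *)
Definition kernel_functional b phi (y : R -> R) : \bar R :=
  \int[mu]_t \int[mu]_s (b t s * phi (y s))%:E.

Lemma measurable_kernel_integral b phi x :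
    measurable_fun [set: mR * mR] (fun p => b p.1 p.2) ->
    (forall t s, 0 <= b t s)%R -> continuous phi -> (forall r, 0 <= phi r)%R ->
  measurable_fun [set: mR] (fun t => \int[mu]_s (b t s * phi (L0_fun x s))%:E).
Proof.
move=> mb b0 cphi phi0.
apply: (@measurable_fun_fubini_tonelli_F _ _ _ _ _ mu
  (fun p : mR * mR => (b p.1 p.2 * phi (L0_fun x p.2))%:E)); last first.
  by move=> p; rewrite lee_fin mulr_ge0.
apply/measurable_EFinP; apply: measurable_funM => //.
apply: (@measurableT_comp _ _ _ _ _ _ phi).
  exact: continuous_measurable_fun.
by apply: (measurableT_comp (measurable_L0_fun x)); exact: measurable_snd.
Qed.

(* Lower semicontinuity: along a sequence converging fast enough in measure the
   functions converge almost everywhere, and Fatou's lemma applies twice. *)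
Lemma kernel_functional_dist_open b phi (a : \bar R) :
    measurable_fun [set: mR * mR] (fun p => b p.1 p.2) ->
    (forall t s, 0 <= b t s)%R -> continuous phi -> (forall r, 0 <= phi r)%R ->
  dist_open (@distL0 R) [set x | a < kernel_functional b phi (L0_fun x)].
Proof.
move=> mb b0 cphi phi0 x /= ax; apply: contrapT => nball.
have far n : exists z, distL0 x z < (2^-1 ^+ n)%R%:E /\
    kernel_functional b phi (L0_fun z) <= a.
  apply: contrapT => nfar; apply: nball; exists (2^-1 ^+ n)%R => [|z xz].
    by rewrite exprn_gt0// invr_gt0.
  by rewrite /= ltNge; apply/negP => za; apply: nfar; exists z.
have [z xz] := choice far.
have zx := distL0_cvg_ae (fun n => (xz n).1).
have mbt t : measurable_fun [set: mR] (b t : mR -> mR).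
  exact: (measurableT_comp mb (pair1_measurable t)).
have inner0 y t : 0 <= \int[mu]_s (b t s * phi (L0_fun y s))%:E.
  by apply: integral_ge0 => s _; rewrite lee_fin mulr_ge0.
have minner y := measurable_kernel_integral y mb b0 cphi phi0.
suff : kernel_functional b phi (L0_fun x) <= a by rewrite leNgt ax.
apply: (@le_trans _ _ (\int[mu]_t
    limn_einf (fun n => \int[mu]_s (b t s * phi (L0_fun (z n) s))%:E))).
  apply: ge0_le_integral => //.
    by apply: measurable_fun_limn_einf => n; exact: minner.
  by move=> t _; exact: fatou_comp.
apply: le_trans (fatou mu measurableT (fun n => minner (z n)) _) _ => //.
by apply: limn_einf_le => n; exact: (xz n).2.
Qed.

Lemma measurable_kernel_functional b phi :
    measurable_fun [set: mR * mR] (fun p => b p.1 p.2) ->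
    (forall t s, 0 <= b t s)%R -> continuous phi -> (forall r, 0 <= phi r)%R ->
  measurable_fun [set: borelL0 R] (fun x => kernel_functional b phi (L0_fun x)).
Proof.
move=> mb b0 cphi phi0.
apply: emeasurable_fun_lt => r; apply: sub_sigma_algebra.
exact: kernel_functional_dist_open.
Qed.

(** Truncation only decreases the integrand, and Hölder's inequality against the constant [1] bounds
    the first norm by the second, as the interval has measure [1]. The embedding of [H] in [L0] is
    thus continuous, hence Borel. *)
Lemma distL0_le_distH (x z : H R) :
  distL0 (LebesgueSpace.sort x) (LebesgueSpace.sort z) <= distH x z.
Proof.
have mh : measurable_fun [set: mR] (fun t => H_fun x t - H_fun z t : R)%R.
  by apply: measurable_funB; exact: measurable_H_fun.
have m1 : measurable_fun [set: mR] (cst 1%R : mR -> R) by [].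
have half : (2^-1 + 2^-1 = 1 :> R)%R by lra.
have := hoelder mu mh m1 (ltr0Sn R 1) (ltr0Sn R 1) half.
have -> : EFin \o cst 1%R = cst 1 :> (mR -> \bar R) by [].
rewrite Lnorm_cst1 [X in X `^ _]leb01_setT poweR1r mule1; apply: le_trans.
rewrite Lnorm1; apply: ge0_le_integral => //.
- exact: measurable_distL0_integrand.
- apply: measurableT_comp => //; apply/measurable_EFinP.
  by apply: measurable_funM.
- by move=> t _; rewrite /= lee_fin mulr1 ge_min lexx.
Qed.

Lemma measurable_H_L0 :
  measurable_fun [set: borelH R] (fun x : borelH R => LebesgueSpace.sort x : borelL0 R).
Proof.
apply: (@measurability _ _ (borelH R) (borelL0 R) setT _ (dist_open (@distL0 R))).
  by [].
move=> _ [U oU <-]; rewrite setTI; apply: sub_sigma_algebra => x /= Ux.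
have [r r0 xU] := oU _ Ux; exists r => // z xz; apply: xU.
exact: le_lt_trans (distL0_le_distH x z) xz.
Qed.

Lemma measurable_kernel_functional_H b phi :
    measurable_fun [set: mR * mR] (fun p => b p.1 p.2) ->
    (forall t s, 0 <= b t s)%R -> continuous phi -> (forall r, 0 <= phi r)%R ->
  measurable_fun [set: borelH R]
    (fun v : borelH R => kernel_functional b phi (H_fun v)).
Proof.
move=> mb b0 cphi phi0.
exact: (measurableT_comp (measurable_kernel_functional mb b0 cphi phi0)
  measurable_H_L0).
Qed.

Lemma kernel_functional_cst1 phi (y : R -> R) : (forall r, 0 <= phi r)%R ->
  kernel_functional (fun _ _ => 1%R) phi y = \int[mu]_s (phi (y s))%:E.
Proof.
move=> phi0; rewrite /kernel_functional integral_cst//.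
rewrite [X in _ * X]leb01_setT mule1.
by apply: eq_integral => s _; rewrite mul1r.
Qed.

Lemma normHE (y : R -> R) : normH y = (\int[mu]_s (y s ^+ 2)%:E) `^ 2^-1.
Proof.
rewrite /normH unlock; congr (_ `^ _); apply: eq_integral => s _.
by rewrite /= powR_mulrn// -normrX ger0_norm// sqr_ge0.
Qed.

Lemma measurable_normH_L0 : measurable_fun [set: borelL0 R] (fun x => normH (L0_fun x)).
Proof.
rewrite (_ : (fun _ => _) = (fun x : borelL0 R =>
    kernel_functional (fun _ _ => 1%R) (fun r => r ^+ 2)%R (L0_fun x) `^ 2^-1)).
  apply: (measurableT_comp (measurable_poweR _)).
  apply: measurable_kernel_functional => //; first exact: exprn_continuous.
  by move=> r; exact: sqr_ge0.
apply/funext => x; rewrite normHE kernel_functional_cst1// => r.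
exact: sqr_ge0.
Qed.

Lemma measurable_normH :
  measurable_fun [set: borelH R] (fun v : borelH R => normH (H_fun v)).
Proof. exact: (measurableT_comp measurable_normH_L0 measurable_H_L0). Qed.

(** For [r >= 0] the supremum norm exceeds [r] exactly when the positive part of [|y| - r] has a
    positive integral, and that integral is a kernel functional. *)
Lemma measurable_norm_sup :
  measurable_fun [set: borelH R] (fun v : borelH R => norm_sup (H_fun v)).
Proof.
apply: emeasurable_fun_lt => r.
have [r0|r0] := ltP r 0%R.
  rewrite (_ : mkset _ = setT)//; apply/seteqP; split=> x //= _.
  by apply: lt_le_trans (Lnorm_ge0 _ _ _); rewrite lte_fin.
pose phi (q : R) := Num.max (`|q| - r)%R 0%R.
have phi0 q : (0 <= phi q)%R by rewrite le_max lexx orbT.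
have cphi : continuous phi.
  move=> q; apply: (@continuous_max _ _ (fun q : R => `|q| - r)%R (cst 0%R)).
    by apply: cvgB; [exact: cvg_norm|exact: cvg_cst].
  exact: cvg_cst.
rewrite (_ : mkset _ =
  [set x | 0 < kernel_functional (fun _ _ => 1%R) phi (H_fun x)]).
  rewrite -[X in measurable X]setTI.
  by apply: emeasurable_fun_o_infty => //; apply: measurable_kernel_functional_H.
have mphi (x : H R) : measurable_fun [set: mR] (fun s => (phi (H_fun x s))%:E : \bar R).
  apply/measurable_EFinP.
  apply: (@measurableT_comp _ _ _ _ _ _ phi); last exact: measurable_H_fun.
  exact: continuous_measurable_fun.
have norm_supP (x : H R) :
    (norm_sup (H_fun x) <= r%:E) <-> \int[mu]_s (phi (H_fun x s))%:E = 0.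
  have -> : \int[mu]_s (phi (H_fun x s))%:E = \int[mu]_s `|(phi (H_fun x s))%:E|.
    by apply: eq_integral => s _; rewrite gee0_abs// lee_fin.
  rewrite ae_eq_integral_abs//.
  (* The norm of infinite exponent is defined by cases on the total mass, here [1]. *)
  rewrite /norm_sup unlock /= [X in 0 < X]leb01_setT lte01.
  split.
    move=> /ess_supP h.
    apply: (@filterS _ _ (ae_filter_ringOfSetsType mu) _ _ _ h) => s /= + _.
    by rewrite lee_fin => xr; congr EFin; rewrite /phi max_r// subr_le0.
  move=> h; apply/ess_supP.
  apply: (@filterS _ _ (ae_filter_ringOfSetsType mu) _ _ _ h) => s /= /(_ I)[].
  rewrite lee_fin -subr_le0 => <-.
  by rewrite /phi le_max lexx.
apply/seteqP; split=> x /=; rewrite kernel_functional_cst1//.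
  move=> rx; rewrite lt_neqAle integral_ge0 ?andbT//.
    by apply/eqP => /esym/norm_supP; rewrite leNgt rx.
  by move=> s _; rewrite lee_fin.
move=> ix; rewrite ltNge; apply/negP => /norm_supP x0.
by rewrite x0 ltxx in ix.
Qed.
End functionals.

(** * Deterministic inequalities for one step of the model *)

Section pathwise.
Variable R : realType.
Local Notation mu := (leb01 R).
Local Notation mR := (measurableTypeR R).

Lemma le_poweR (x z : \bar R) (p : R) : (0 <= p)%R -> 0 <= x -> x <= z ->
  x `^ p <= z `^ p.
Proof.
move=> p0 x0 xz; apply: gt0_ler_poweR => //.
  by rewrite in_itv /= leey andbT.
by rewrite in_itv /= leey andbT (le_trans x0).
Qed.

(** With [(1 + eta) ^ p = lambda]: if [a <= eta * b], then [a + b <= (1 + eta) * b]; otherwise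
    [b < a / eta] and [a + b <= (1 + 1 / eta) * a]. This covers all [p > 0], whether or not the
    power is convex. *)
Lemma poweRD_le (p lambda : R) : (0 < p)%R -> (1 < lambda)%R ->
  exists2 C : R, (0 <= C)%R & forall a b : \bar R, 0 <= a -> 0 <= b ->
    (a + b) `^ p <= C%:E * a `^ p + lambda%:E * b `^ p.
Proof.
move=> p0 l1; have l0 : (0 < lambda)%R by rewrite (lt_trans _ l1).
pose eta := (lambda `^ p^-1 - 1)%R.
have eta0 : (0 < eta)%R.
  have : (1 `^ p^-1 < lambda `^ p^-1)%R.
    by apply: gt0_ltr_powR; rewrite ?invr_gt0 ?nnegrE// ltW.
  by rewrite powR1 subr_gt0.
have etaE : ((1 + eta) `^ p = lambda)%R.
  by rewrite /eta addrC subrK -powRrM mulVf ?gt_eqF// powRr1// ltW.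
clearbody eta; exists ((1 + eta^-1) `^ p)%R; first exact: powR_ge0.
move=> a b a0 b0; have [ab|ba] := leP a (eta%:E * b).
  apply: (@le_trans _ _ (lambda%:E * b `^ p)); last first.
    by rewrite leeDr// mule_ge0 ?poweR_ge0// lee_fin powR_ge0.
  have eb : (1 + eta)%:E * b = eta%:E * b + b.
    by rewrite addrC EFinD ge0_muleDl ?mul1e// lee_fin ltW.
  rewrite -etaE -poweR_EFin -poweRM// ?lee_fin ?addr_ge0 ?(ltW eta0)//.
  by rewrite le_poweR ?(ltW p0) ?adde_ge0// eb leeD2r.
apply: (@le_trans _ _ (((1 + eta^-1) `^ p)%R%:E * a `^ p)); last first.
  by rewrite leeDl// mule_ge0 ?poweR_ge0// lee_fin ltW.
have ei0 : (0 <= eta^-1)%R by rewrite invr_ge0 ltW.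
have ea : (1 + eta^-1)%:E * a = a + eta^-1%:E * a.
  by rewrite EFinD ge0_muleDl ?mul1e// lee_fin.
rewrite -poweR_EFin -poweRM// ?lee_fin ?addr_ge0//.
rewrite le_poweR ?(ltW p0) ?adde_ge0// ea leeD2l//.
rewrite -[leLHS]mul1e -(@mulVf _ eta) ?gt_eqF// EFinM -muleA.
by rewrite lee_wpmul2l ?lee_fin// ltW.
Qed.

Lemma integral_sqr_ge0 (v : R -> R) : 0 <= \int[mu]_s (v s ^+ 2)%:E.
Proof. by apply: integral_ge0 => s _; rewrite lee_fin sqr_ge0. Qed.

Lemma poweR_abs2 (r : R) : `|r%:E| `^ 2 = (r ^+ 2)%:E.
Proof. by rewrite /= powR_mulrn// -normrX ger0_norm// sqr_ge0. Qed.

Lemma cauchy_schwarz_integral (f g : R -> R) :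
    measurable_fun [set: mR] (f : mR -> mR) ->
    measurable_fun [set: mR] (g : mR -> mR) ->
  `|\int[mu]_s (f s * g s)%:E| `^ 2 <=
  (\int[mu]_s (f s ^+ 2)%:E) * (\int[mu]_s (g s ^+ 2)%:E).
Proof.
move=> mf mg; have half : (2^-1 + 2^-1 = 1 :> R)%R by lra.
have := hoelder mu mf mg (ltr0Sn R 1) (ltr0Sn R 1) half.
rewrite Lnorm1 => fg.
have mfg : measurable_fun [set: mR] (fun s => (f s * g s)%:E : \bar R).
  by apply/measurable_EFinP; exact: measurable_funM.
have h := le_trans (le_abse_integral mu measurableT mfg) fg.
apply: (le_trans (le_poweR _ _ h)) => //.
rewrite poweRM ?Lnorm_ge0// !poweR_Lnorm//.
under eq_integral do rewrite poweR_abs2.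
by under [X in _ * X <= _]eq_integral do rewrite poweR_abs2.
Qed.

Lemma normH_poweR (v : R -> R) (alpha : R) :
  normH v `^ alpha = (\int[mu]_s (v s ^+ 2)%:E) `^ (alpha / 2).
Proof. by rewrite normHE -poweRrM mulrC. Qed.

Lemma integral_sqr_H_lty (x : H R) : \int[mu]_s (H_fun x s ^+ 2)%:E < +oo.
Proof.
have : normH (H_fun x) < +oo by exact: (@Lebesgue_finite _ _ _ _ _ _ x).
by rewrite normHE; apply: lty_poweRy; rewrite invr_eq0.
Qed.

Variable beta : R -> R -> R.
Hypothesis mbeta : measurable_fun [set: mR * mR] (fun p => beta p.1 p.2).

(** Square of [K] at the pointwise square of [x], whence the fourth power. *)
Definition Ksq (x : R -> R) : \bar R :=
  kernel_functional (fun t s => beta t s ^+ 2)%R (fun r => (r ^+ 2) ^+ 2)%R x.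

Lemma Ksq_ge0 x : 0 <= Ksq x.
Proof.
apply: integral_ge0 => t _; apply: integral_ge0 => s _.
by rewrite lee_fin mulr_ge0 ?sqr_ge0.
Qed.

Lemma measurable_Ksq :
  measurable_fun [set: borelH R] (fun x : borelH R => Ksq (H_fun x)).
Proof.
apply: (@measurable_kernel_functional_H _ (fun t s => beta t s ^+ 2)%R
  (fun r => (r ^+ 2) ^+ 2)%R).
- exact: measurable_funX.
- by move=> t s; exact: sqr_ge0.
- under eq_fun do rewrite -exprM; exact: exprn_continuous.
- by move=> r; exact: sqr_ge0.
Qed.

Lemma K_poweR (x : R -> R) (alpha : R) :
  K beta (fun s => x s ^+ 2)%R `^ alpha = Ksq x `^ (alpha / 2).
Proof. by rewrite /K -poweRrM mulrC. Qed.

Lemma volatility_step (delta e v v' : H R) (y : L0 R) (c lambda : R) :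
    (0 <= c)%R -> (0 <= lambda)%R ->
    (forall a b : \bar R, 0 <= a -> 0 <= b ->
      (a + b) `^ 2 <= c%:E * a `^ 2 + lambda%:E * b `^ 2) ->
    nonneg_fun (H_fun v') ->
    (\forall t \ae mu, L0_fun y t = H_fun e t * Num.sqrt (H_fun v' t))%R ->
    (\forall t \ae mu, (H_fun v t)%:E =
       (H_fun delta t)%:E + kernel_op beta (fun s => L0_fun y s ^+ 2)%R t) ->
  \int[mu]_t (H_fun v t ^+ 2)%:E <=
  c%:E * \int[mu]_t (H_fun delta t ^+ 2)%:E +
  lambda%:E * (Ksq (H_fun e) * \int[mu]_t (H_fun v' t ^+ 2)%:E).
Proof.
move=> c0 l0 split v'0 ye veq.
have mbt t : measurable_fun [set: mR] (beta t : mR -> mR).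
  exact: (measurableT_comp mbeta (pair1_measurable t)).
have me := measurable_H_fun e; have mv := measurable_H_fun v.
have mv' := measurable_H_fun v'; have md := measurable_H_fun delta.
have mkop t : measurable_fun [set: mR] (fun s => beta t s * H_fun e s ^+ 2 : R)%R.
  apply: measurable_funM; [exact: mbt|exact: measurable_funX].
(* Non-negativity of [v'] makes the square of its square root equal to [v'], so [y ^ 2] is
   [e ^ 2 * v'] almost everywhere. *)
have kopE t : kernel_op beta (fun s => L0_fun y s ^+ 2)%R t =
    \int[mu]_s (beta t s * H_fun e s ^+ 2 * H_fun v' s)%:E.
  apply: ae_eq_integral => //.
  - apply/measurable_EFinP; apply: measurable_funM; first exact: mbt.
    by apply: measurable_funX; exact: measurable_L0_fun.
  - apply/measurable_EFinP.
    by apply: measurable_funM; [exact: mkop|exact: mv'].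
  - have := @filterI _ _ (ae_filter_ringOfSetsType mu) _ _ v'0 ye.
    apply: (@filterS _ _ (ae_filter_ringOfSetsType mu)) => s /= [s0 ->] _.
    by rewrite exprMn sqr_sqrtr// mulrA.
(* The Cauchy-Schwarz factor at [t]; its integral over [t] is [Ksq]. *)
pose I t := \int[mu]_s (beta t s ^+ 2 * (H_fun e s ^+ 2) ^+ 2)%:E.
have I0 t : 0 <= I t.
  by apply: integral_ge0 => s _; rewrite lee_fin mulr_ge0 ?sqr_ge0.
have mI : measurable_fun [set: mR] I.
  apply: (@measurable_kernel_integral _ (fun t s => beta t s ^+ 2)%R
    (fun r => (r ^+ 2) ^+ 2)%R).
  - exact: measurable_funX.
  - by move=> t s; exact: sqr_ge0.
  - under eq_fun do rewrite -exprM; exact: exprn_continuous.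
  - by move=> r; exact: sqr_ge0.
pose Q' := \int[mu]_t (H_fun v' t ^+ 2)%:E.
have Q'0 : 0 <= Q' by exact: integral_sqr_ge0.
have msq (x : H R) : measurable_fun [set: mR] (fun t => (H_fun x t ^+ 2)%:E : \bar R).
  by apply/measurable_EFinP; apply: measurable_funX; exact: measurable_H_fun.
apply: (@le_trans _ _ (\int[mu]_t
    (c%:E * (H_fun delta t ^+ 2)%:E + lambda%:E * (I t * Q')))).
  apply: ae_ge0_le_integral => //.
  - by move=> t _; rewrite lee_fin sqr_ge0.
  - by move=> t _; rewrite adde_ge0 ?mule_ge0// lee_fin// sqr_ge0.
  - apply: emeasurable_funD; first exact: measurable_funeM.
    by apply: measurable_funeM; apply: emeasurable_funM.
  - apply: (@filterS _ _ (ae_filter_ringOfSetsType mu) _ _ _ veq) => t /= vt _.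
    rewrite -poweR_abs2 vt.
    apply: (le_trans (le_poweR _ _ (lee_abs_add _ _))) => //.
    apply: (le_trans (split _ _ _ _)) => //.
    rewrite poweR_abs2 leeD2l// lee_wpmul2l ?lee_fin// kopE.
    apply: (le_trans (cauchy_schwarz_integral (mkop t) mv')).
    by rewrite lee_wpmul2r// /I; under eq_integral do rewrite exprMn.
rewrite ge0_integralD//; last 4 first.
- by move=> t _; rewrite mule_ge0// lee_fin// sqr_ge0.
- exact: measurable_funeM.
- by move=> t _; rewrite !mule_ge0.
- by apply: measurable_funeM; apply: emeasurable_funM.
rewrite ge0_integralZl//; last by move=> t _; rewrite lee_fin sqr_ge0.
rewrite leeD2l// ge0_integralZl//; last 2 first.
- exact: emeasurable_funM.
- by move=> t _; rewrite mule_ge0.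
by rewrite ge0_integralZr.
Qed.

(** Trading [v] for [1 + v ^ 2] expresses the bound through the squared norm of [v], the quantity
    that the recursion controls. *)
Lemma integral_sqr_product_le (e v : H R) (y : L0 R) :
    nonneg_fun (H_fun v) ->
    (\forall t \ae mu, L0_fun y t = H_fun e t * Num.sqrt (H_fun v t))%R ->
  \int[mu]_t (L0_fun y t ^+ 2)%:E <=
  norm_sup (H_fun e) `^ 2 * (1 + \int[mu]_t (H_fun v t ^+ 2)%:E).
Proof.
move=> v0 ye.
have mv := measurable_H_fun v.
have msup : \forall t \ae mu, `|(H_fun e t)%:E| <= norm_sup (H_fun e).
  rewrite /norm_sup unlock /= [X in 0 < X]leb01_setT lte01.
  exact: (ess_sup_ge mu (abse \o (EFin \o H_fun e))).
have S0 : 0 <= norm_sup (H_fun e) by exact: Lnorm_ge0.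
have mv2 : measurable_fun [set: mR] (fun t => (1 + H_fun v t ^+ 2)%:E : \bar R).
  by apply/measurable_EFinP; apply: measurable_funD => //; exact: measurable_funX.
have v20 t : 0 <= (1 + H_fun v t ^+ 2)%:E.
  by rewrite lee_fin addr_ge0// sqr_ge0.
apply: (@le_trans _ _ (\int[mu]_t (norm_sup (H_fun e) `^ 2 * (1 + H_fun v t ^+ 2)%:E))).
  apply: ae_ge0_le_integral => //.
  - by move=> t _; rewrite lee_fin sqr_ge0.
  - by apply/measurable_EFinP; apply: measurable_funX; exact: measurable_L0_fun.
  - by move=> t _; rewrite mule_ge0// poweR_ge0.
  - exact: measurable_funeM.
  - have h := @filterI _ _ (ae_filter_ringOfSetsType mu) _ _ v0 ye.
    have := @filterI _ _ (ae_filter_ringOfSetsType mu) _ _ h msup.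
    apply: (@filterS _ _ (ae_filter_ringOfSetsType mu)) => t /= [[t0 ->] st] _.
    rewrite exprMn sqr_sqrtr// EFinM -poweR_abs2.
    apply: (@le_trans _ _ (norm_sup (H_fun e) `^ 2 * (H_fun v t)%:E)).
      by rewrite lee_wpmul2r ?lee_fin// le_poweR.
    rewrite lee_wpmul2l ?poweR_ge0// lee_fin.
    have := sqr_ge0 (H_fun v t - 1)%R; nra.
rewrite ge0_integralZl ?poweR_ge0// lee_wpmul2l ?poweR_ge0//.
under eq_integral do rewrite EFinD.
rewrite ge0_integralD//; last 2 first.
- by move=> t _; rewrite lee_fin sqr_ge0.
- by apply/measurable_EFinP; exact: measurable_funX.
by rewrite integral_cst// [X in 1 * X]leb01_setT mule1.
Qed.

End pathwise.

(** * One-dimensional laws of a stationary pair *)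

Section stationarity.
Context (R : realType) (d d1 d2 : measure_display) (Omega : measurableType d).
Context (S1 : measurableType d1) (S2 : measurableType d2).
Variable P : probability Omega R.

Lemma strictly_stationary_snd (y : int -> Omega -> S1) (v : int -> Omega -> S2)
    (B : set S2) (k : int) :
    strictly_stationary P (fun k w => (y k w, v k w)) -> measurable B ->
  P (v k @^-1` B) = P (v 0%R @^-1` B).
Proof.
move=> stat mB.
pose A : set (int -> (S1 * S2)%type) := [set f | B (f 0%R).2].
have := stat k A; rewrite /A /= add0r; apply; apply: sub_sigma_algebra.
exists 0%R, (snd @^-1` B); split => //.
by rewrite -[X in measurable X]setTI; exact: measurable_snd.
Qed.
End stationarity.

(** * The recursion for the powers of the volatility norm *)

Section moments.
Context (R : realType) (d : measure_display) (Omega : measurableType d).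
Variable P : probability Omega R.
Variables (eps : int -> {RV P >-> borelH R}) (delta : H R) (beta : R -> R -> R).
Variable alpha : R.
Variables (y : int -> {RV P >-> borelL0 R}) (sigma2 : int -> {RV P >-> borelH R}).
Hypothesis eps_iid : iid eps.
Hypothesis mbeta : measurable_fun [set: measurableTypeR R * measurableTypeR R]
  (fun p => beta p.1 p.2).
Hypothesis alpha_gt0 : (0 < alpha)%R.
Hypothesis K_moment :
  \int[P]_w (K beta (fun s => H_fun (eps 1%R w) s ^+ 2)%R `^ alpha) < 1.
Hypothesis sol : garch_solution eps delta beta y sigma2.
Hypothesis stat : strictly_stationary P (fun k w => (y k w, sigma2 k w)).

Let measurable_K :
  measurable_fun setT (fun x : borelH R => K beta (fun s => H_fun x s ^+ 2)%R `^ alpha).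
Proof.
under eq_fun do rewrite K_poweR.
exact: (measurableT_comp (measurable_poweR _) (measurable_Ksq mbeta)).
Qed.

Let measurable_normH_poweR :
  measurable_fun setT (fun x : borelH R => normH (H_fun x) `^ alpha).
Proof. exact: (measurableT_comp (measurable_poweR _) (@measurable_normH R)). Qed.

(** The factor is [kappa ^ 2] because the recursion splits a power of a sum twice, losing one
    [kappa] each time. *)
Lemma ex_gt1_K_moment : exists2 kappa : R, (1 < kappa)%R &
  \int[P]_w ((kappa ^+ 2)%R%:E *
    K beta (fun s => H_fun (eps 1%R w) s ^+ 2)%R `^ alpha) < 1.
Proof.
set rho := \int[P]_w (K beta (fun s => H_fun (eps 1%R w) s ^+ 2)%R `^ alpha).
have rho0 : 0 <= rho by apply: integral_ge0 => w _; exact: poweR_ge0.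
have [r r01 rE] : exists2 r : R, (0 <= r < 1)%R & rho = r%:E.
  move: rho0 K_moment; rewrite -/rho; case: rho => [r||]//=.
  by rewrite lee_fin lte_fin => r0 r1; exists r; rewrite ?r0.
have mKe : measurable_fun setT
    (fun w => K beta (fun s => H_fun (eps 1%R w) s ^+ 2)%R `^ alpha).
  exact: (measurableT_comp measurable_K (measurable_funPT (eps 1%R))).
(* With [x = (1 - r) / 4], [kappa ^ 2 * r = (1 + x) ^ 2 * (1 - 4 * x) = 1 - 2 * x - 7 * x ^ 2 - 4 *
   x ^ 3 < 1]. *)
exists (1 + (1 - r) / 4)%R; first lra.
rewrite ge0_integralZl//; last by rewrite lee_fin sqr_ge0.
  by rewrite -/rho rE -EFinM lte_fin; nra.
by move=> w _; exact: poweR_ge0.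
Qed.

Lemma volatility_recursion (kappa : R) : (1 < kappa)%R ->
  exists2 C : R, (0 <= C)%R & forall k, \forall w \ae P,
    normH (H_fun (sigma2 k w)) `^ alpha <= C%:E +
      (kappa ^+ 2)%R%:E *
      K beta (fun s => H_fun (eps (k - 1)%R w) s ^+ 2)%R `^ alpha *
      normH (H_fun (sigma2 (k - 1)%R w)) `^ alpha.
Proof.
move=> kappa1; have kappa0 : (0 < kappa)%R by rewrite (lt_trans _ kappa1).
have a20 : (0 < alpha / 2)%R by rewrite divr_gt0.
(* The first split, at exponent [2], costs [lambda]; this choice makes it cost exactly [kappa] once
   raised to [alpha / 2]. The second split, at exponent [alpha / 2], costs the other [kappa]. *)
pose lambda := (kappa `^ (alpha / 2)^-1)%R.
have lambda1 : (1 < lambda)%R.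
  have : (1 `^ (alpha / 2)^-1 < lambda)%R.
    by apply: gt0_ltr_powR; rewrite ?invr_gt0 ?nnegrE// ltW.
  by rewrite powR1.
have lambdaE : (lambda `^ (alpha / 2) = kappa)%R.
  by rewrite /lambda -powRrM mulVf ?gt_eqF// powRr1// ltW.
have lambda0 : (0 <= lambda)%R by exact: powR_ge0.
have [c c0 cP] := poweRD_le (ltr0Sn R 1) lambda1.
have [C C0 CP] := poweRD_le a20 kappa1.
set D := c%:E * \int[leb01 R]_t (H_fun delta t ^+ 2)%:E.
have D0 : 0 <= D by rewrite mule_ge0 ?integral_sqr_ge0.
have Dfin : C%:E * D `^ (alpha / 2) \is a fin_num.
  rewrite fin_numM// ge0_fin_numE ?poweR_ge0//; apply: poweR_lty.
  rewrite /D; apply: lte_mul_pinfty => //; exact: integral_sqr_H_lty.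
exists (fine (C%:E * D `^ (alpha / 2))).
  by rewrite fine_ge0// mule_ge0// poweR_ge0.
move=> k; have [s0 ye ve] := sol.
have := ye (k - 1)%R; have := ve k; apply: filterS2 => w vw yw.
rewrite fineK// !normH_poweR K_poweR.
have step := volatility_step mbeta c0 lambda0 cP (s0 (k - 1)%R w) yw vw.
apply: (le_trans (le_poweR (ltW a20) (integral_sqr_ge0 _) step)).
have HQ0 : 0 <= Ksq beta (H_fun (eps (k - 1)%R w)) *
    \int[leb01 R]_t (H_fun (sigma2 (k - 1)%R w) t ^+ 2)%:E.
  by rewrite mule_ge0 ?Ksq_ge0 ?integral_sqr_ge0.
apply: (le_trans (CP _ _ D0 _)); first by rewrite mule_ge0.
rewrite leeD2l// poweRM// poweR_EFin lambdaE poweRM ?Ksq_ge0 ?integral_sqr_ge0//.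
by rewrite expr2 EFinM !muleA.
Qed.

Lemma garch_integral_lty (u : borelH R -> \bar R) :
    measurable_fun setT u -> (forall x, 0 <= u x) ->
    \int[P]_w u (eps 0%R w) < +oo ->
  \int[P]_w (u (eps 0%R w) * normH (H_fun (sigma2 0%R w)) `^ alpha) < +oo.
Proof.
move=> mu u0 u_lty.
have [kappa kappa1 Kkappa] := ex_gt1_K_moment.
have [C C0 rec] := volatility_recursion kappa1.
pose f (x : borelH R) := (kappa ^+ 2)%R%:E *
  K beta (fun s => H_fun x s ^+ 2)%R `^ alpha.
pose M k w := normH (H_fun (sigma2 k w)) `^ alpha.
apply: (@recursion_integral_lty _ _ _ _ _ P eps eps_iid f u _ _ _ mu u0 u_lty M C).
- exact: measurable_funeM.
- by move=> x; rewrite mule_ge0 ?poweR_ge0// lee_fin sqr_ge0.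
- exact: Kkappa.
- move=> k.
  exact: (measurableT_comp measurable_normH_poweR (measurable_funPT (sigma2 k))).
- by move=> k w; exact: poweR_ge0.
- move=> w; rewrite /M normH_poweR; apply: poweR_lty; exact: integral_sqr_H_lty.
- move=> k b.
  pose B : set (borelH R) := [set x | b%:E < normH (H_fun x) `^ alpha].
  have mB : measurable B by rewrite -[B]setTI; exact: emeasurable_fun_o_infty.
  exact: (strictly_stationary_snd k stat mB).
- exact: C0.
- exact: rec.
Qed.

End moments.

(** * From the weighted moment to the two bounds *)

Theorem proposition2p1 (R : realType) (d : measure_display)
    (Omega : measurableType d) (P : probability Omega R)
    (eps : int -> {RV P >-> borelH R}) (delta : H R) (beta : R -> R -> R)
    (alpha : R)
    (y : int -> {RV P >-> borelL0 R}) (sigma2 : int -> {RV P >-> borelH R})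
    (eps_iid : iid eps)
    (delta_ge0 : nonneg_fun (H_fun delta))
    (beta_bounded : bounded_kernel_operator beta)
    (beta_ge0 : nonneg_operator beta)
    (alpha_gt0 : (0 < alpha)%R)
    (K_moment :
      \int[P]_w (K beta (fun s => H_fun (eps 1%R w) s ^+ 2)%R `^ alpha) < 1)
    (sol : garch_solution eps delta beta y sigma2)
    (stat : strictly_stationary P (fun k w => (y k w, sigma2 k w))) :
  \int[P]_w (normH (H_fun (sigma2 0%R w)) `^ alpha) < +oo /\
  (\int[P]_w (normH (fun t => Num.sqrt (H_fun (sigma2 0%R w) t)) `^ alpha)
     < +oo ->
   \int[P]_w (norm_sup (H_fun (eps 0%R w)) `^ alpha) < +oo ->
   \int[P]_w (normH (L0_fun (y 0%R w)) `^ alpha) < +oo).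
Proof.
have [mbeta _ _] := beta_bounded.
split=> [|_ sup_lty].
  have := garch_integral_lty eps_iid mbeta alpha_gt0 K_moment sol stat
    (u := cst 1) (measurable_cst _) (fun=> lee01).
  rewrite integral_cst// [X in 1 * X]probability_setT mule1 => /(_ (ltry 1)).
  by under eq_integral do rewrite mul1e.
pose u (x : borelH R) := norm_sup (H_fun x) `^ alpha.
have mu : measurable_fun setT u.
  exact: (measurableT_comp (measurable_poweR _) (@measurable_norm_sup R)).
have u0 x : 0 <= u x by exact: poweR_ge0.
have mue : measurable_fun setT (fun w => u (eps 0%R w)).
  exact: (measurableT_comp mu (measurable_funPT (eps 0%R))).
have uM_lty :=
  garch_integral_lty eps_iid mbeta alpha_gt0 K_moment sol stat mu u0 sup_lty.
have a20 : (0 < alpha / 2)%R by rewrite divr_gt0.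
(* No contraction is at stake here, so any constant above [1] serves; [2] is taken. *)
have [C C0 CP] := @poweRD_le R (alpha / 2) 2 a20 (ltr1n _ 2).
pose M w := normH (H_fun (sigma2 0%R w)) `^ alpha.
have mM : measurable_fun setT M.
  exact: (measurableT_comp (measurable_poweR alpha)
    (measurableT_comp (@measurable_normH R) (measurable_funPT (sigma2 0%R)))).
have M0 w : 0 <= M w by exact: poweR_ge0.
have muM : measurable_fun setT (fun w => u (eps 0%R w) * M w).
  exact: emeasurable_funM.
have uM0 w : 0 <= u (eps 0%R w) * M w by rewrite mule_ge0.
(* With [S] the supremum norm of [eps 0] and [Q] the squared norm of [sigma2 0], [(S ^ 2 * (1 + Q))
   ^ (alpha / 2) <= S ^ alpha * (C + 2 * Q ^ (alpha / 2))]. *)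
apply: (@le_lt_trans _ _
    (\int[P]_w (C%:E * u (eps 0%R w) + 2%:E * (u (eps 0%R w) * M w)))); last first.
  rewrite ge0_integralD//; last 4 first.
  - by move=> w _; rewrite mule_ge0.
  - exact: measurable_funeM.
  - by move=> w _; rewrite mule_ge0.
  - exact: measurable_funeM.
  rewrite !ge0_integralZl// lte_add_pinfty// lte_mul_pinfty//.
apply: ae_ge0_le_integral => //.
- by move=> w _; exact: poweR_ge0.
- exact: (measurableT_comp (measurable_poweR alpha)
    (measurableT_comp (@measurable_normH_L0 R) (measurable_funPT (y 0%R)))).
- by move=> w _; rewrite adde_ge0// mule_ge0.
- by apply: emeasurable_funD; exact: measurable_funeM.
have [s0 ye _] := sol.
apply: filterS (ye 0%R) => w yw _.
have S0 : 0 <= norm_sup (H_fun (eps 0%R w)) by exact: Lnorm_ge0.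
rewrite normH_poweR.
apply: (le_trans (le_poweR (ltW a20) (integral_sqr_ge0 _)
  (integral_sqr_product_le (s0 0%R w) yw))).
have Q0 := adde_ge0 lee01 (integral_sqr_ge0 (H_fun (sigma2 0%R w))).
rewrite poweRM ?poweR_ge0// -poweRrM.
rewrite mulrCA mulfV ?mulr1 ?pnatr_eq0// -/(u _).
apply: (le_trans (lee_wpmul2l (u0 _) (CP _ _ lee01 (integral_sqr_ge0 _)))).
rewrite poweR1r mule1 -normH_poweR -/(M w).
by rewrite ge0_muleDr ?mule_ge0// muleC [u _ * (2%:E * _)]muleCA.
Qed.
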